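(* Let $\lambda$ be a partition with $r$ parts, $\rho=(r-1,\dots,0)$, $\Theta\in\{\Gamma,\Delta\}^r$, $1\le i\le r-1$ with $\Theta_i\ne\Theta_{i+1}$, and $\sigma\in\mathcal P^r$. Then the map $t_{r-i}:\mathfrak S^\Theta_{\lambda+\rho}\to\mathfrak S^{s_i\Theta}_{\lambda+\rho}$ restricts to a map $\mathfrak S^\Theta_{\lambda+\rho,\sigma}\to\mathfrak S^{s_i\Theta}_{\lambda+\rho,s_i\sigma}$, where $s_i\sigma$ is $\sigma$ with $\sigma_i$ and $\sigma_{i+1}$ swapped.
   Context: Palette $\mathcal P=\{c_1<\dots<c_m\}$; fix $\kappa\in\mathcal P^r$ and an integer $N\ge\lambda_1+r$. Fused crystal vertices: left/right and top/bottom edges each carry $\varnothing$ or one colour. Configurations (left, top, right, bottom), parameter $z$, unlisted weight $0$. Gamma: $(\varnothing,\varnothing,\varnothing,\varnothing)\mapsto1$; $(c_a,c_b,c_a,c_b)\mapsto0$ if $a<b$, $z$ if $a\ge b$; $(c_a,c_b,c_b,c_a)\mapsto z$ if $a<b$, $0$ if $a>b$; $(\varnothing,c_a,\varnothing,c_a)\mapsto0$; $(c_a,\varnothing,c_a,\varnothing)\mapsto z$; $(c_a,\varnothing,\varnothing,c_a)\mapsto z$; $(\varnothing,c_a,c_a,\varnothing)\mapsto1$. Delta: $(\varnothing,\varnothing,\varnothing,\varnothing)\mapsto z$; $(c_a,c_b,c_a,c_b)\mapsto1$ if $a\le b$, $0$ if $a>b$; $(c_b,c_b,c_a,c_a)\mapsto0$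 if $a<b$, $1$ if $a>b$; $(\varnothing,c_a,\varnothing,c_a)\mapsto0$; $(c_a,\varnothing,c_a,\varnothing)\mapsto1$; $(\varnothing,\varnothing,c_a,c_a)\mapsto z$; $(c_a,c_a,\varnothing,\varnothing)\mapsto1$. Lattice: rows $1..r$ top to bottom, columns $0..N-1$ right to left; row $t$ vertices of type $\Theta_t$, parameter $z_t$. $\mathfrak S^\Theta_{\lambda+\rho,\sigma}$: edge labellings with all vertex weights nonzero, top boundary edge of column $\lambda_t+r-t$ carrying $\kappa_t$ ($t=1..r$), other top edges and all bottom edges empty, and in row $t$: if $\Theta_t=\Gamma$ the left boundary edge is empty and the right one carries $\sigma_t$, if $\Theta_t=\Delta$ the right one is empty and the left one carries $\sigma_t$. $\mathfrak S^\Theta_{\lambda+\rho}=\bigsqcup_\sigma\mathfrak S^\Theta_{\lambda+\rho,\sigma}$. Gelfand–Tsetlin patterns: arrays $(a_{j,l})_{0\le j\le l\le r-1}$ of nonnegative integers with $a_{j-1,l-1}\ge a_{j,l}\ge a_{j-1,l}$; $\mathrm{GTP}^{\Theta'}_\nu$ ($\Theta'\in\{\Gamma,\Delta\}^{r-1}$): patterns with top row $\nu$ whose row pair $(j-1,j)$ satisfies $a_{j-1,l-1}>a_{j,l}$ for all $l$ if $\Theta'_j=\Gamma$, and $a_{j,l}>a_{j-1,l}$ for all $l$ if $\Theta'_j=\Delta$. $\iota_\Theta:\mathfrak S^\Theta_{\lambda+\rho}\to\mathrm{GTP}^{(\Theta_1,\dots,\Theta_{r-1})}_{\lambda+\rho}$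 sends a state to the pattern whose row $j$ lists in decreasing order the column numbers of occupied vertical edges directly below lattice row $j$ (row $0$: top boundary); it is a bijection. The involution $t_{r-i}$ on patterns changes only row $i$, replacing $a_{i,l}$ by $\min(a_{i-1,l-1},a_{i+1,l})+\max(a_{i-1,l},a_{i+1,l+1})-a_{i,l}$ (nonexistent entries of row $i+1$ omitted); when $\Theta_i\ne\Theta_{i+1}$ it maps $\mathrm{GTP}^{(\Theta_1,\dots,\Theta_{r-1})}_{\lambda+\rho}$ onto $\mathrm{GTP}^{((s_i\Theta)_1,\dots,(s_i\Theta)_{r-1})}_{\lambda+\rho}$. On states, $t_{r-i}:=\iota_{s_i\Theta}^{-1}\circ t_{r-i}\circ\iota_\Theta:\mathfrak S^\Theta_{\lambda+\rho}\to\mathfrak S^{s_i\Theta}_{\lambda+\rho}$, where $s_i\Theta$ swaps $\Theta_i,\Theta_{i+1}$. *)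

(* Defs.v *)
(* Fused Gamma and Delta crystal ice: states, Gelfand-Tsetlin patterns, and
   the involutions on states induced by toggling one row of a pattern.

   The palette c_1 < ... < c_m is 'I_m with its order as natural numbers; an
   edge label is an option 'I_m, None being the empty edge.  Lattice rows are
   numbered from 0, top to bottom, so the t-th row in the usual 1-based
   numbering has index t.-1.  Columns are numbered 0 .. N.-1 from right to
   left. *)
From HB Require Import structures.
From mathcomp Require Import all_boot all_order all_algebra all_fingroup.

Set Implicit Arguments.
Unset Strict Implicit.
Unset Printing Implicit Defensive.

Import GRing.Theory.

Inductive row_type := Gamma | Delta.

Section Weights.

Variables (R : nzRingType) (m : nat).
Implicit Types (z : R) (left top right bottom : option 'I_m).

(* When all four edges carry the same colour both coloured patterns match;
   testing the straight-through one first gives that configuration its listed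
   weight (z for Gamma, 1 for Delta). *)
Definition gamma_weight z left top right bottom : R :=
  match left, top, right, bottom with
  | None, None, None, None => 1%R
  | Some a, Some b, Some a', Some b' =>
      if (a' == a) && (b' == b) then (if (a < b)%N then 0%R else z)
      else if (a' == b) && (b' == a) then (if (a < b)%N then z else 0%R)
      else 0%R
  | None, Some a, None, Some a' => 0%R
  | Some a, None, Some a', None => if a' == a then z else 0%R
  | Some a, None, None, Some a' => if a' == a then z else 0%R
  | None, Some a, Some a', None => if a' == a then 1%R else 0%R
  | _, _, _, _ => 0%R
  end.

Definition delta_weight z left top right bottom : R :=
  match left, top, right, bottom with
  | None, None, None, None => z
  | Some x, Some y, Some a, Some v =>
      if (x == a) && (v == y) then (if (a <= y)%N then 1%R else 0%R)
      else if (y == x) && (v == a) then (if (a < x)%N then 0%R else 1%R)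
      else 0%R
  | None, Some a, None, Some a' => 0%R
  | Some a, None, Some a', None => if a' == a then 1%R else 0%R
  | None, None, Some a, Some a' => if a' == a then z else 0%R
  | Some a, Some a', None, None => if a' == a then 1%R else 0%R
  | _, _, _, _ => 0%R
  end.

Definition vertex_weight (T : row_type) z left top right bottom : R :=
  match T with
  | Gamma => gamma_weight z left top right bottom
  | Delta => delta_weight z left top right bottom
  end.

End Weights.

(* Exchange of the entries at positions i and j of a tuple. *)
Definition swap (T : Type) (r : nat) (i j : 'I_r) (s : r.-tuple T) :
  r.-tuple T := [tuple tnth s (tperm i j t) | t < r].

Definition rho (r : nat) : r.-tuple nat := [tuple r - t.+1 | t < r].

Definition add_rho (r : nat) (la : r.-tuple nat) : r.-tuple nat :=
  [tuple tnth la t + tnth (rho r) t | t < r].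

Section Labelling.

Variables m r N : nat.

(* An edge labelling of the r x N lattice is a pair (h, v).
   h t k, with k : 'I_N.+1, is the horizontal edge of row t at the right of
   column k, which is also the one at the left of column k - 1; k = 0 is the
   right boundary and k = N the left one.
   v j c, with j : 'I_r.+1, is the vertical edge in column c directly below
   the first j rows; j = 0 is the top boundary and j = r the bottom one. *)
Definition labelling : finType :=
  ('M[option 'I_m]_(r, N.+1) * 'M[option 'I_m]_(r.+1, N))%type.

Implicit Types (s : labelling) (t : 'I_r) (c : 'I_N).

Definition left_edge s t c := s.1 t (lift ord0 c).
Definition right_edge s t c := s.1 t (widen_ord (leqnSn N) c).
Definition top_edge s t c := s.2 (widen_ord (leqnSn r) t) c.
Definition bottom_edge s t c := s.2 (lift ord0 t) c.

End Labelling.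

(* Patterns (a_{j,l}) with 0 <= j <= l <= r - 1 are stored as the tuple of
   their rows, row j being the list a_{j,j}, a_{j,j+1}, ..., a_{j,r-1}. *)
Definition pattern (r : nat) := r.-tuple (seq nat).

Definition entry (r : nat) (p : pattern r) (j l : nat) : nat :=
  nth 0 (nth [::] p j) (l - j).

Section Patterns.

Variable r : nat.

(* GTP for the sequence of the first r - 1 entries of Theta: since t < l < r,
   the last entry of Theta is never used. *)
Definition GTP (nu : r.-tuple nat) (Theta : r.-tuple row_type) :
  pred (pattern r) := fun p =>
  [&& nth [::] p 0 == nu :> seq nat,
      [forall j : 'I_r, size (tnth p j) == r - j]
    & [forall t : 'I_r, forall l : 'I_r, (t < l) ==>
        [&& entry p t.+1 l <= entry p t l.-1,
            entry p t l <= entry p t.+1 l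
          & match tnth Theta t with
            | Gamma => entry p t.+1 l < entry p t l.-1
            | Delta => entry p t l < entry p t.+1 l
            end]]].

(* The involution t_{r-i}: it changes row i (i > 0) of the pattern only.  The
   subtraction does not truncate on patterns satisfying the interlacing
   inequalities. *)
Definition toggle_entry (i : nat) (p : pattern r) (l : nat) : nat :=
  let upper := if i.+1 <= l < r
               then minn (entry p i.-1 l.-1) (entry p i.+1 l)
               else entry p i.-1 l.-1 in
  let lower := if i.+1 <= l.+1 < r
               then maxn (entry p i.-1 l) (entry p i.+1 l.+1)
               else entry p i.-1 l in
  upper + lower - entry p i l.

Definition toggle (i : nat) (p : pattern r) : pattern r :=
  [tuple if j == i :> nat then [seq toggle_entry i p l | l <- iota i (r - i)]
         else tnth p j | j < r].

End Patterns.

Section States.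

Variables (R : nzRingType) (m r N : nat) (z : 'I_r -> R).
Variables (kappa : r.-tuple 'I_m) (la : r.-tuple nat).
Implicit Types (s : labelling m r N) (Theta : r.-tuple row_type).

Definition admissible Theta s : bool :=
  [forall t : 'I_r, forall c : 'I_N,
    vertex_weight (tnth Theta t) (z t) (left_edge s t c) (top_edge s t c)
      (right_edge s t c) (bottom_edge s t c) != 0%R].

Definition top_boundary s : bool :=
  [forall t : 'I_r, forall c : 'I_N,
    (c == tnth (add_rho la) t :> nat) ==> (s.2 ord0 c == Some (tnth kappa t))]
  && [forall c : 'I_N,
       ((c : nat) \notin add_rho la) ==> (s.2 ord0 c == None)].

Definition bottom_boundary s : bool :=
  [forall c : 'I_N, s.2 ord_max c == None].

Definition side_boundary Theta (sigma : r.-tuple 'I_m) s : bool :=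
  [forall t : 'I_r,
    match tnth Theta t with
    | Gamma => (s.1 t ord_max == None) && (s.1 t ord0 == Some (tnth sigma t))
    | Delta => (s.1 t ord0 == None) && (s.1 t ord_max == Some (tnth sigma t))
    end].

Definition states_with Theta (sigma : r.-tuple 'I_m) :
  {set labelling m r N} :=
  [set s | [&& admissible Theta s, top_boundary s, bottom_boundary s
             & side_boundary Theta sigma s]].

Definition states Theta : {set labelling m r N} :=
  \bigcup_(sigma : r.-tuple 'I_m) states_with Theta sigma.

(* Row j lists the occupied columns at level j in decreasing order. *)
Definition state_pattern s : pattern r :=
  [tuple [seq val c | c <- rev (enum 'I_N)
                    & isSome (s.2 (widen_ord (leqnSn r) j) c)] | j < r].

(* Inverse of the bijection state_pattern from states Theta to
   GTP (add_rho la) Theta: the unique state with pattern p.  It is None if p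
   is not in GTP, or if it has no preimage or more than one. *)
Definition pattern_state Theta (p : pattern r) : option (labelling m r N) :=
  if GTP (add_rho la) Theta p
  then unset1 [set s in states Theta | state_pattern s == p]
  else None.

(* The map t_{r-j} on states, for adjacent rows i and j = i + 1: the level
   between these two rows is level j, hence row j of the pattern. *)
Definition toggle_state (i j : 'I_r) Theta s : option (labelling m r N) :=
  pattern_state (swap i j Theta) (toggle j (state_pattern s)).

End States.

(* Main.v *)
(* Read a Gamma row from left to right and a Delta row from right to left.  At
   every step the horizontal edge (the hand) meets the top edge; when both
   edges leaving the vertex are coloured, they carry the two colours sorted,
   and otherwise a colour is only passed on.  So a row is determined by its top
   edges and by the set of occupied bottom edges, and it acts on colours by one
   conditional swap per occupied bottom edge, which is active exactly when that
   edge lies in the same column as the top edge being met.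

   Let p, q, b be three consecutive rows of the pattern, separated by a Gamma
   and a Delta row.  Each q_l lies in an interval [L_l, U_l] determined by p
   and b, and toggling sends q_l to U_l + L_l - q_l.  All active swaps are
   functions of the bits x_l = (q_l == L_l) (x_l = (q_l == U_l) for a Delta row
   above a Gamma row), and of the comparison of p_{l+1} with b_l.  If H, G are
   the hands of the Gamma and Delta rows in the order Gamma-Delta, and H', G'
   those in the order Delta-Gamma, then (G_l, H'_l) is (H_l, G'_{l+1}) after a
   swap conditioned on x_l; a finite check on three colours propagates this
   from one l to the next.  At both ends it says that the boundary colours are
   exchanged, and in between that the colours below the two rows agree. *)
Require Import Defs.
From HB Require Import structures.
From mathcomp Require Import all_boot all_order all_algebra all_fingroup.
From mathcomp Require Import zify.

Set Implicit Arguments.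
Unset Strict Implicit.
Unset Printing Implicit Defensive.

(** * Sorting colours along two rows *)

Section Sort.
Variable m : nat.
Implicit Types (a b k : 'I_m) (x y : bool).

Definition sort2 x a b : 'I_m * 'I_m := if x && (b < a) then (b, a) else (a, b).

(** Both sides are words in conditional sorts of neighbours in the triple (H, k, W). If [b] and [p]
    differ, one sort on each side is idle and the words coincide. If they agree, two set bits give
    the braid relation s1 s2 s1 = s2 s1 s2 for sorting operators, and a single set bit gives
    idempotency. *)
Lemma site_exchange (p b : nat) x y (H k W : 'I_m) :
  let al := (b <= p) && x in let be := (p <= b) && x in
  let al' := (p <= b) && y in let be' := (b <= p) && y in
  let R := sort2 al H k in let R' := sort2 al' k W in
  let B1 := sort2 y R.2 W in let B0 := sort2 x H R'.1 in
  let E := sort2 be R.1 B1.1 in let E' := sort2 be' B0.2 R'.2 in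
  [/\ E.1 = B0.1, E.2 = E'.1 & E'.2 = B1.2].
Proof.
rewrite /sort2; case: x; case: y; case: (ltngtP b p) => _ /=.
all: repeat (case: ifP => /=).
all: try by move=> *; split.
all: by move=> *; split; apply: val_inj => /=; lia.
Qed.
End Sort.

Section Runs.
Variable m : nat.
Implicit Types (x al be : nat -> bool) (k d e H G : nat -> 'I_m) (sg : 'I_m).

(** The index l follows decreasing columns. The hand is empty until its first top edge, whose colour
    it takes: [k 0] from the left for Gamma, [k n] from the right for Delta. As [sort2] puts the
    smaller colour first, an active swap leaves the smaller colour below a Gamma row and the larger
    one below a Delta row. *)
Definition gamma_run n al k d sg := exists H,
  [/\ H 0 = k 0, H n = sg
    & forall l, l < n -> sort2 (al l) (H l) (k l.+1) = (d l, H l.+1)].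

Definition delta_run n al k d sg := exists G,
  [/\ G n = k n, G 0 = sg
    & forall l, l < n -> sort2 (al l) (k l) (G l.+1) = (G l, d l)].

Lemma gamma_hand al k :
  exists H, H 0 = k 0 /\ forall l, H l.+1 = (sort2 (al l) (H l) (k l.+1)).2.
Proof.
by exists (nat_rect _ (k 0) (fun l a => (sort2 (al l) a (k l.+1)).2)).
Qed.

Lemma delta_hand n al k :
  exists G, G n = k n /\
    forall l, l < n -> G l = (sort2 (al l) (k l) (G l.+1)).1.
Proof.
elim: n al k => [|n IHn] al k; first by exists k.
have [G [Gn GS]] := IHn (al \o succn) (k \o succn).
exists (fun l => if l is l'.+1 then G l' else (sort2 (al 0) (k 0) (G 0)).1).
by split=> // -[|l] //; apply: GS.
Qed.

Section Exchange.
Variables (u : nat) (p b : nat -> nat) (x al be al' be' : nat -> bool).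
(** [al], [be] are the active swaps in the order Gamma-Delta, [al'], [be'] those in the order
    Delta-Gamma. At the two ends no entry of [b] competes with [p], so [x] alone decides. *)
Hypothesis alE : forall l, l < u -> al l = (b l <= p l.+1) && x l.
Hypothesis beE : forall l, l < u -> be l = (p l.+1 <= b l) && x l.
Hypothesis al'E : forall l, l < u -> al' l.+1 = (p l.+1 <= b l) && x l.+1.
Hypothesis be'E : forall l, l < u -> be' l = (b l <= p l.+1) && x l.+1.
Hypothesis al_last : al u = x u.
Hypothesis al'_first : al' 0 = x 0.

(* With H, G the hands of the Gamma and Delta rows in the order Gamma-Delta, and
   G', H' those in the order Delta-Gamma, the invariant of both exchange lemmas
   is sort2 (x l) (H l) (G' l.+1) = (G l, H' l). *)
Lemma gamma_delta_exchange k d e sg1 sg2 :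
  gamma_run u.+1 al k d sg1 -> delta_run u be d e sg2 ->
  exists d', delta_run u.+1 al' k d' sg2 /\ gamma_run u be' d' e sg1.
Proof.
move=> [H [H0 Hu HS]] [G [Gu G0 GS]].
have [G' [G'u G'S]] := delta_hand u.+1 al' k.
pose B l := sort2 (x l) (H l) (G' l.+1).
have BG l : l <= u -> (B l).1 = G l.
  (* Descending induction, because the Delta hands are known at the right end. *)
  have [j] := ubnP (u - l); elim: j l => // j IHj l lej lu.
  have := HS l lu; have [->|ltlu] := eqVneq l u.
    by move=> Eu; rewrite /B G'u -al_last Eu Gu.
  have {ltlu} ltlu : l < u by lia.
  have := site_exchange (p l.+1) (b l) (x l) (x l.+1) (H l) (k l.+1) (G' l.+2).
  rewrite /= -alE // -beE // -al'E // -be'E // => -[E _ _] R.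
  move: E; rewrite R /= -/(B l.+1) IHj //; last by lia.
  by rewrite GS //= -G'S // => ->.
exists (fun l => (sort2 (al' l) (k l) (G' l.+1)).2); split.
  exists G'; split=> // [|l lu]; last by rewrite (G'S l) // -surjective_pairing.
  by rewrite -G0 -BG // G'S // al'_first /B H0.
(* The second half of the invariant supplies the lower Gamma hand. *)
exists (fun l => (B l).2); split=> [||l lu].
- by rewrite /B H0 al'_first.
- by rewrite /B G'u -al_last HS.
have := site_exchange (p l.+1) (b l) (x l) (x l.+1) (H l) (k l.+1) (G' l.+2).
rewrite /= -alE // -beE // -al'E // -be'E // HS /=; last by lia.
rewrite -/(B l.+1) -G'S // BG // GS //= -/(B l) => -[_ E1 E2].
by rewrite E1 -E2 -surjective_pairing.
Qed.

Lemma delta_gamma_exchange k d e sg1 sg2 :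
  delta_run u.+1 al' k d sg2 -> gamma_run u be' d e sg1 ->
  exists d', gamma_run u.+1 al k d' sg1 /\ delta_run u be d' e sg2.
Proof.
move=> [G' [G'u G'0 G'S]] [H' [H'0 H'u H'S]].
have [H [H0 HS]] := gamma_hand al k.
pose B l := sort2 (x l) (H l) (G' l.+1).
have BH l : l <= u -> (B l).2 = H' l.
  (* Ascending induction, because the Gamma hands are known at the left end. *)
  elim: l => [|l IHl] lu; first by rewrite /B H0 -al'_first G'S // H'0.
  have := site_exchange (p l.+1) (b l) (x l) (x l.+1) (H l) (k l.+1) (G' l.+2).
  rewrite /= -alE // -beE // -al'E // -be'E // => -[_ _].
  by rewrite G'S //= -/(B l) (IHl (ltnW lu)) H'S //= -HS => <-.
exists (fun l => (sort2 (al l) (H l) (k l.+1)).1); split.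
  exists H; split=> // [|l lu]; last by rewrite HS -surjective_pairing.
  by rewrite HS al_last -G'u -/(B u) BH.
exists (fun l => (B l).1); split=> [||l lu].
- by rewrite /B G'u -al_last.
- by rewrite /B H0 -al'_first G'S.
have := site_exchange (p l.+1) (b l) (x l) (x l.+1) (H l) (k l.+1) (G' l.+2).
rewrite /= -alE // -beE // -al'E // -be'E // G'S //=.
rewrite -HS -/(B l) -/(B l.+1) (BH l (ltnW lu)) H'S //= => -[E1 E2 _].
by rewrite -E1 -E2 -surjective_pairing.
Qed.

End Exchange.
End Runs.

(** * Rows as particle systems *)

Section Rows.
Variable m : nat.
Implicit Types (T : row_type) (a b k : 'I_m) (oa ot ob od : option 'I_m).
Implicit Types (V : nat -> option 'I_m) (g : nat -> option 'I_m).

(* The hand is the horizontal edge crossed while a Gamma row is read from left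
   to right and a Delta row from right to left: the hand and the top edge meet
   at the vertex, and [hand_sort] returns the colours of the bottom edge and of
   the next hand. *)
Definition hand_sort T (x : bool) a b : 'I_m * 'I_m :=
  if T is Gamma then sort2 x a b else let: (c, d) := sort2 x b a in (d, c).

Lemma hand_sortF T a b : hand_sort T false a b = (a, b).
Proof. by case: T. Qed.

(** Arguments: hand before, top edge, hand after, bottom edge. A top colour met by an empty hand
    must enter the hand, since passing straight down has weight 0. *)
Definition step T oa ot ob od : bool :=
  match oa, ot, ob, od with
  | None, None, None, None => true
  | Some a, Some t, Some b, Some d => (d, b) == hand_sort T true a t
  | Some a, None, Some b, None => b == a
  | Some a, None, None, Some d => d == a
  | None, Some t, Some b, None => b == t
  | _, _, _, _ => false
  end.

(** The nonzero weights are [z] and 1. Exchanging left and right for Delta turns both supports into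
    the same rule, up to which colour is dropped when two meet. *)
Lemma vertex_weight_neq0 (R : nzRingType) T (z : R) ol ot oR ob :
  (z != 0)%R ->
  (vertex_weight T z ol ot oR ob != 0%R) =
  if T is Gamma then step T ol ot oR ob else step T oR ot ol ob.
Proof.
move=> z0; have [zE oneE zeroE] :
  [/\ (z != 0)%R = true, (1 != 0 :> R)%R = true & (0 != 0 :> R)%R = false].
  by rewrite z0 GRing.oner_eq0 eqxx.
case: T; case: ol => [l|]; case: ot => [t|]; case: oR => [ri|]; case: ob => [b|] //=.
all: rewrite /sort2 /= -?[_ == _ :> 'I_m]val_eqE /=.
all: repeat (case: ifP => /=); rewrite ?zE ?oneE ?zeroE ?xpair_eqE.
all: rewrite -?[_ == _ :> 'I_m]val_eqE /=.
all: by move=> *; lia.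
Qed.

Fixpoint scan T V0 V1 (cs : seq nat) oa ob : Prop :=
  if cs is c :: cs' then exists2 oa', step T oa (V0 c) oa' (V1 c)
                                    & scan T V0 V1 cs' oa' ob
  else oa = ob.

Lemma scanP T V0 V1 cs oa ob :
  scan T V0 V1 cs oa ob <->
  exists g, [/\ g 0 = oa, g (size cs) = ob &
    forall i, i < size cs ->
      step T (g i) (V0 (nth 0 cs i)) (g i.+1) (V1 (nth 0 cs i))].
Proof.
elim: cs oa => [|c cs IHcs] oa /=.
  by split=> [->|[g [<- <-]]] //; exists (fun=> ob).
split=> [[oa' st /IHcs[g [g0 gn gS]]]|[g [g0 gn gS]]].
  exists (fun i => if i is i'.+1 then g i' else oa).
  by split=> // -[|i] lti /=; [rewrite g0 | apply: gS].
exists (g 1); first by rewrite -g0; apply: (gS 0).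
apply/IHcs; exists (g \o succn); split=> // i lti.
exact: (gS i.+1).
Qed.

Definition before T : rel nat := fun c d => if T is Gamma then d < c else c < d.

Lemma before_trans T : transitive (before T).
Proof. by case: T => y x z /=; [move=> ? /ltn_trans-> | apply: ltn_trans]. Qed.

Lemma before_irr T : irreflexive (before T).
Proof. by case: T => x /=; apply: ltnn. Qed.

Section Particles.
Variables (T : row_type) (V0 V1 : nat -> option 'I_m) (sg : 'I_m).

Definition hd_after (p : nat) (Q : seq nat) :=
  if Q is q :: _ then before T p q else true.

(** The hand [a] must be dropped at the next bottom column q, no later than the next top column p;
    if q = p, the two colours meet and the swap is active. The hand then holds a colour again from p
    on, so the next drop lies strictly after p. *)
Fixpoint particles a (P Q : seq nat) : Prop :=
  match P, Q with
  | [::], [::] => a = sg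
  | p :: P', q :: Q' =>
      [/\ (q == p) || before T q p, hd_after p Q'
        & exists2 k, V0 p = Some k &
          V1 q = Some (hand_sort T (q == p) a k).1 /\
          particles (hand_sort T (q == p) a k).2 P' Q']
  | _, _ => False
  end.

Let occ V cs := [seq c <- cs | isSome (V c)].

Lemma hd_afterP c cs V : path (before T) c cs -> hd_after c (occ V cs).
Proof.
rewrite path_sortedE ?before_trans; last exact: before_trans.
case/andP=> /allP cP _; case E: (occ V cs) => [|d s] //=.
by apply: cP; move: (mem_head d s); rewrite -E mem_filter => /andP[].
Qed.

(** Empty and nonempty hands are treated together, because a column can turn either into the
    other. *)
Lemma scan_particles cs : sorted (before T) cs ->
  (forall a, scan T V0 V1 cs (Some a) (Some sg) <->
             particles a (occ V0 cs) (occ V1 cs)) /\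
  (scan T V0 V1 cs None (Some sg) <->
   if occ V0 cs is p :: P then
     hd_after p (occ V1 cs) /\
     exists2 k, V0 p = Some k & particles k P (occ V1 cs)
   else False).
Proof.
elim: cs => [_|c cs IHcs /= cs_path].
  by split=> [a|] /=; split=> // [[]|->].
have cs_sorted := path_sorted cs_path.
have [IHS IHN] := IHcs cs_sorted.
have Aft V := @hd_afterP c cs V cs_path.
have befF d : before T c d -> (c == d) || before T c d.
  by move=> ->; rewrite orbT.
have befN d : before T c d -> (d == c) || before T d c -> False.
  move=> cd /orP[/eqP E|dc]; first by rewrite E before_irr in cd.
  by have := before_trans cd dc; rewrite before_irr.
move: (Aft V0) (Aft V1); rewrite /occ /=.
case E0: (V0 c) => [k|]; case E1: (V1 c) => [d|] /=;
  rewrite -/(occ V0 cs) -/(occ V1 cs) => Aft0 Aft1.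
(* The four cases: column [c] is occupied above and below, only above, only below, or not at all. *)
- split=> [a|].
    rewrite eqxx; split=> [[[b|//] /eqP E]|[_ _ [k' ]]].
      move/IHS; split=> //; exists k; rewrite -?E //.
    rewrite E0 => -[<-]; rewrite E1 => -[[Ed]] /IHS R.
    by exists (Some (hand_sort T true a k).2); rewrite ?Ed -?surjective_pairing.
  by split=> [[[b|]]|[]] //; rewrite before_irr.
- split=> [a|].
    split=> [[[b|] //]|].
    by case: (occ V1 cs) Aft1 => // q Q /befN cq [/cq].
  split=> [[[b|//] /eqP-> /IHS R]|[_ [k']]]; first by split=> //; exists k.
  by rewrite E0 => -[<-] /IHS R; exists (Some k).
- split=> [a|].
    split=> [[[b|]] //= /eqP Ed /IHN|].
      case: (occ V0 cs) Aft0 => // p P cp [pQ [k E R]]; split=> //; first exact: befF.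
      have -> : (c == p) = false by apply/eqP=> Ec; move: cp; rewrite /= Ec before_irr.
      by exists k; rewrite // hand_sortF E1 Ed.
    case: (occ V0 cs) Aft0 IHN => // p P cp IHN [_ pQ].
    have -> : (c == p) = false by apply/eqP=> Ec; move: cp; rewrite /= Ec before_irr.
    rewrite E1 => -[k E [[->]]]; rewrite hand_sortF => R; exists None => //=.
    by apply/IHN; split=> //; exists k.
  split=> [[[b|] //]|].
  by case: (occ V0 cs) Aft0 => // p P cp [pc]; case: (befN p cp); rewrite pc orbT.
- split=> [a|].
    split=> [[[b|//] /eqP-> /IHS //]|/IHS R].
    by exists (Some a).
  split=> [[[b|]] // _ /IHN //|/IHN R].
  by exists None.
Qed.
End Particles.
End Rows.

(** * Rows as interlacing conditions together with sorting runs *)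

Section RowRuns.
Variable m : nat.
Implicit Types (T : row_type) (a b : 'I_m) (k d : nat -> 'I_m).
Implicit Types (V h : nat -> option 'I_m) (sg : 'I_m) (P Q : seq nat).

Definition colours V P k := forall l, l < size P -> V (nth 0 P l) = Some (k l).

Lemma colours_cons V p P k :
  colours V (p :: P) k -> V p = Some (k 0) /\ colours V P (k \o succn).
Proof. by move=> kP; split=> [|l lP]; [apply: (kP 0) | apply: (kP l.+1)]. Qed.

Lemma particlesP T V0 V1 sg a P Q k d : colours V0 P k -> colours V1 Q d ->
  particles T V0 V1 sg a P Q <->
  [/\ size P = size Q,
      forall l, l < size Q ->
        ((nth 0 Q l == nth 0 P l) || before T (nth 0 Q l) (nth 0 P l)) /\
        (l.+1 < size Q -> before T (nth 0 P l) (nth 0 Q l.+1))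
    & exists H, [/\ H 0 = a, H (size Q) = sg & forall l, l < size Q ->
        hand_sort T (nth 0 Q l == nth 0 P l) (H l) (k l) = (d l, H l.+1)]].
Proof.
elim: P Q a k d => [|p P IHP] [|q Q] a k d kP dQ /=; try by split=> // -[].
  split=> [->|[_ _ [H [<- <-]]] //]; by split=> //; exists (fun=> sg).
have {kP} [k0 /IHP{}IHP] := colours_cons kP.
have {dQ} [d0 /IHP{}IHP] := colours_cons dQ.
split=> [[qp pQ [k' kE [dE /IHP[sz PQ [H [H0 Hn HS]]]]]]|[[sz] PQ [H [H0 Hn HS]]]].
  move: kE; rewrite k0 => -[Ek]; rewrite -{}Ek d0 in dE H0; case: dE => dE.
  split=> [|[|l] lQ|]; first by rewrite sz.
  - by split=> //=; case: (Q) pQ.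
  - exact: PQ.
  exists (fun l => if l is l'.+1 then H l' else a); split=> // -[_|l lQ] /=.
    by rewrite dE H0 -surjective_pairing.
  exact: HS.
have [qp pQ] := PQ 0 isT; split=> //; first by case: (Q) pQ => //= q' Q' ->.
exists (k 0) => //; have := HS 0 isT; rewrite /= -H0 d0 => -> /=; split=> //.
apply/IHP; split=> // [l lQ|]; first exact: (PQ l.+1).
by exists (H \o succn); split=> // l lQ; apply: (HS l.+1).
Qed.

(** The first top particle only fills the empty hand. Hence [P] is longer by one, and drop number l
    faces top particle l+1. *)
Lemma scan_runP T V0 V1 sg cs k d : sorted (before T) cs ->
  let P := [seq c <- cs | isSome (V0 c)] in
  let Q := [seq c <- cs | isSome (V1 c)] in
  colours V0 P k -> colours V1 Q d ->
  scan T V0 V1 cs None (Some sg) <->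
  [/\ size P = (size Q).+1,
      forall l, l < size Q -> before T (nth 0 P l) (nth 0 Q l) /\
        ((nth 0 Q l == nth 0 P l.+1) || before T (nth 0 Q l) (nth 0 P l.+1))
    & exists H, [/\ H 0 = k 0, H (size Q) = sg & forall l, l < size Q ->
        hand_sort T (nth 0 Q l == nth 0 P l.+1) (H l) (k l.+1) = (d l, H l.+1)]].
Proof.
move=> cs_sorted P Q kP dQ.
have [_] := scan_particles V0 V1 sg cs_sorted; rewrite -/P -/Q => ->.
case: P kP => [|p P] kP; first by split=> // -[].
have {kP} [k0 /particlesP/(_ dQ)kP] := colours_cons kP.
split=> [[pQ [k' kE /kP[sz PQ [H [H0 Hn HS]]]]]|[[sz] PQ [H [H0 Hn HS]]]].
  move: kE; rewrite k0 => -[Ek]; rewrite -{}Ek in H0.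
  split=> [|l lQ|]; first by rewrite /= sz.
    split; last by case: (PQ l lQ).
    case: l lQ => [|l] lQ /=; first by case: (Q) lQ pQ.
    by case: (PQ l (ltnW lQ)) => _; apply.
  by exists H.
split; first by case: (Q) PQ => //= q Q' /(_ 0 isT)[].
exists (k 0) => //; apply/kP; split=> // [l lQ|]; last by exists H.
by split=> [|lQ']; [case: (PQ l lQ) | case: (PQ l.+1 lQ')].
Qed.

Definition columns T N := if T is Gamma then rev (iota 0 N) else iota 0 N.

Lemma columns_sorted T N : sorted (before T) (columns T N).
Proof. by case: T => /=; rewrite ?rev_sorted iota_ltn_sorted. Qed.

Lemma size_columns T N : size (columns T N) = N.
Proof. by case: T; rewrite /= ?size_rev size_iota. Qed.

Lemma nth_columns T N i : i < N ->
  nth 0 (columns T N) i = if T is Gamma then N - i.+1 else i.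
Proof.
move=> iN; case: T => /=; rewrite ?nth_rev ?size_iota // nth_iota //; lia.
Qed.

(** Horizontal edges are numbered from the right, so after i columns of a Gamma row the hand is edge
    N - i. *)
Definition hand T N h i : option 'I_m := if T is Gamma then h (N - i) else h i.

Definition row_ok T N h V0 V1 sg :=
  [/\ hand T N h 0 = None, hand T N h N = Some sg
    & forall i, i < N -> let c := nth 0 (columns T N) i in
        step T (hand T N h i) (V0 c) (hand T N h i.+1) (V1 c)].

Lemma row_okP T N V0 V1 sg :
  (exists h, row_ok T N h V0 V1 sg) <->
  scan T V0 V1 (columns T N) None (Some sg).
Proof.
rewrite scanP size_columns; split=> [[h [h0 hN hS]]|[g [g0 gN gS]]].
  by exists (hand T N h).
(* On indices up to N, [hand T N] is an involution, so it also converts hands back to edges. *)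
exists (hand T N g).
have E i : i <= N -> hand T N (hand T N g) i = g i.
  by case: T {gS} => //= iN; rewrite subKn.
by split=> [||i iN]; rewrite !E //; [apply: gS | apply: ltnW].
Qed.

Definition occupied N V := [seq c <- rev (iota 0 N) | isSome (V c)].

Section Runs.
Variables (N : nat) (V0 V1 : nat -> option 'I_m) (sg : 'I_m) (k d : nat -> 'I_m).
Let P := occupied N V0.
Let Q := occupied N V1.
Hypotheses (kP : colours V0 P k) (dQ : colours V1 Q d).

Lemma gamma_rowP : (exists h, row_ok Gamma N h V0 V1 sg) <->
  [/\ size P = (size Q).+1,
      forall l, l < size Q -> nth 0 P l.+1 <= nth 0 Q l < nth 0 P l
    & gamma_run (size Q) (fun l => nth 0 Q l == nth 0 P l.+1) k d sg].
Proof.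
rewrite row_okP (scan_runP _ (columns_sorted Gamma N) kP dQ) /=.
rewrite -/(occupied N V0) -/(occupied N V1) -/P -/Q.
split=> -[sz PQ R]; split=> // l /PQ; lia.
Qed.

Lemma delta_rowP : (exists h, row_ok Delta N h V0 V1 sg) <->
  [/\ size P = (size Q).+1,
      forall l, l < size Q -> nth 0 P l.+1 < nth 0 Q l <= nth 0 P l
    & delta_run (size Q) (fun l => nth 0 Q l == nth 0 P l) k d sg].
Proof.
have rv V : [seq c <- iota 0 N | isSome (V c)] = rev (occupied N V).
  by rewrite /occupied filter_rev revK.
(* A Delta row meets its particles in increasing columns: the scan sees the reversed lists, and the
   indices are reflected accordingly. *)
have kP' : colours V0 (rev P) (fun l => k (size P - l.+1)).
  by move=> l; rewrite size_rev => lP; rewrite nth_rev // kP //; lia.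
have dQ' : colours V1 (rev Q) (fun l => d (size Q - l.+1)).
  by move=> l; rewrite size_rev => lQ; rewrite nth_rev // dQ //; lia.
rewrite row_okP; have := @scan_runP Delta V0 V1 sg _ _ _ (columns_sorted Delta N).
rewrite /= (rv V0) (rv V1) => /(_ _ _ kP' dQ') ->; rewrite !size_rev -/P -/Q.
set n := size Q.
split=> -[sz PQ [H [H0 Hn HS]]]; split=> //.
- move=> l ln; have := PQ (n - l.+1).
  rewrite !nth_rev ?sz -/n; try by lia.
  have -> : n.+1 - (n - l.+1).+2 = l by lia.
  have -> : n.+1 - (n - l.+1).+1 = l.+1 by lia.
  have -> : n - (n - l.+1).+1 = l by lia.
  by lia.
- exists (fun l => H (n - l)); rewrite subnn subn0 Hn H0 sz subn1; split=> // l ln.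
  have ln' : n - l.+1 < n by lia.
  have := HS _ ln'.
  rewrite !nth_rev ?sz -/n; try by lia.
  have -> : n.+1 - (n - l.+1).+2 = l by lia.
  have -> : n - (n - l.+1).+1 = l by lia.
  have -> : (n - l.+1).+1 = n - l by lia.
  by case: sort2 => x y [-> ->].
- move=> l ln; have := PQ (n - l.+1).
  rewrite !nth_rev ?sz -/n; try by lia.
  have -> : n.+1 - l.+2 = n - l.+1 by lia.
  have -> : n.+1 - l.+1 = (n - l.+1).+1 by lia.
  by lia.
exists (fun l => H (n - l)); rewrite subnn subn0 Hn H0 sz subn1; split=> // l ln.
have ln' : n - l.+1 < n by lia.
  have := HS _ ln'.
rewrite !nth_rev ?sz -/n; try by lia.
have -> : n.+1 - l.+2 = n - l.+1 by lia.
have -> : (n - l.+1).+1 = n - l by lia.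
by case: sort2 => x y [-> ->].
Qed.
End Runs.
End RowRuns.

(** * Toggling the level between two rows *)

Section TwoRows.
Variables (m N : nat).
Implicit Types (T : row_type) (V : nat -> option 'I_m) (sg : 'I_m).
Implicit Types (P Q B : seq nat).

Lemma mem_occupied V c : (c \in occupied N V) = (c < N) && isSome (V c).
Proof. by rewrite mem_filter mem_rev mem_iota andbC. Qed.

Lemma occupied_sorted V : sorted gtn (occupied N V).
Proof.
apply: sorted_filter; first by move=> x y z /= ? /ltn_trans->.
by rewrite rev_sorted iota_ltn_sorted.
Qed.

Lemma colours_occupied sg V :
  colours V (occupied N V) (fun l => odflt sg (V (nth 0 (occupied N V) l))).
Proof.
move=> l /(mem_nth 0); rewrite mem_occupied => /andP[_].
by case: (V _).
Qed.

Definition fill Q (d : nat -> 'I_m) c :=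
  if c \in Q then Some (d (index c Q)) else None.

Lemma occupied_eq V Q : sorted gtn Q ->
  (forall c, c < N -> isSome (V c) = (c \in Q)) -> all (gtn N) Q ->
  occupied N V = Q.
Proof.
move=> Qs VQ /allP QN; apply: (irr_sorted_eq (leT := gtn)) => //.
- by move=> x y z /= ? /ltn_trans->.
- by move=> x; rewrite /= ltnn.
- exact: occupied_sorted.
move=> c; rewrite mem_occupied.
have [/VQ //|cN] := ltnP c N.
by apply/esym/negbTE/negP => /QN /=; rewrite ltnNge cN.
Qed.

Lemma occupied_fill Q d : sorted gtn Q -> all (gtn N) Q ->
  occupied N (fill Q d) = Q.
Proof. by move=> Qs QN; apply: occupied_eq => // c _; rewrite /fill; case: ifP. Qed.

Lemma colours_fill Q d : sorted gtn Q -> colours (fill Q d) Q d.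
Proof.
move=> Qs l lQ; rewrite /fill mem_nth // index_uniq //.
apply: (sorted_uniq (leT := gtn)) => // [x y z /= ? /ltn_trans->//|x].
by rewrite /= ltnn.
Qed.

(** The bounds U_l and, below, L_l of the interval in which the entry q_l may move; entries of [B]
    that do not exist at the ends are omitted. *)
Definition upper P B l :=
  if 0 < l then minn (nth 0 P l) (nth 0 B l.-1) else nth 0 P l.

Definition lower P B l :=
  if l < size B then maxn (nth 0 P l.+1) (nth 0 B l) else nth 0 P l.+1.

Definition reflect_row P Q B :=
  mkseq (fun l => upper P B l + lower P B l - nth 0 Q l) (size Q).

Definition interlaced T P Q := forall l, l < size Q ->
  if T is Gamma then nth 0 P l.+1 <= nth 0 Q l < nth 0 P l
  else nth 0 P l.+1 < nth 0 Q l <= nth 0 P l.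

Definition opposite T := if T is Gamma then Delta else Gamma.

Section Reflection.
Variables (P Q B : seq nat) (u : nat).
Hypothesis szB : size B = u.

(** Opposite row types make both interlacing conditions exclude the same end: U_l for Gamma above
    Delta, L_l for Delta above Gamma. Reflection exchanges the two half-open intervals, and
    therefore the two orders of the types. *)
Lemma interlaced_between T : size Q = u.+1 ->
  interlaced T P Q -> interlaced (opposite T) Q B ->
  forall l, l <= u -> if T is Gamma then lower P B l <= nth 0 Q l < upper P B l
                      else lower P B l < nth 0 Q l <= upper P B l.
Proof.
rewrite /interlaced /upper /lower szB => -> PQ QB l lu.
have := PQ l lu; have := QB l; have := QB l.-1; case: T {PQ QB} => /=;
  by case: (ltnP l u); case: (ltnP 0 l) => /=; case: l lu => /=; lia.
Qed.

Lemma between_interlaced T : size Q = u.+1 ->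
  (forall l, l <= u -> if T is Gamma then lower P B l <= nth 0 Q l < upper P B l
                       else lower P B l < nth 0 Q l <= upper P B l) ->
  interlaced T P Q /\ interlaced (opposite T) Q B.
Proof.
rewrite /interlaced szB => -> LU.
split=> l lu; have := LU l; last have := LU l.+1.
  rewrite /upper /lower szB; case: T {LU};
    by case: (ltnP l u); case: (ltnP 0 l) => /=; lia.
by rewrite /upper /lower szB lu /=; case: T {LU} => /=; lia.
Qed.

Lemma interlaced_sorted T : size Q = u.+1 ->
  interlaced T P Q -> interlaced (opposite T) Q B -> sorted gtn Q.
Proof.
move=> szQ PQ QB; apply/(sortedP 0) => l lQ.
have := PQ l; have := QB l; have := PQ l.+1.
by rewrite szB szQ /=; case: (T) => /=; lia.
Qed.
End Reflection.

Section Exchange.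
Variables (V0 V1 V2 : nat -> option 'I_m) (sg1 sg2 : 'I_m).
Let P := occupied N V0.
Let Q := occupied N V1.
Let B := occupied N V2.

(** Both rows are turned into runs, the coincidences of entries before and after reflection are
    expressed by the bits [x], and the reflected level is filled with the colours that the exchange
    of runs produces. *)
Lemma reflect_rows T :
  (exists h, row_ok T N h V0 V1 sg1) ->
  (exists h, row_ok (opposite T) N h V1 V2 sg2) ->
  exists V, [/\ occupied N V = reflect_row P Q B,
    exists h, row_ok (opposite T) N h V0 V sg2
    & exists h, row_ok T N h V V2 sg1].
Proof.
have kP := @colours_occupied sg1 V0; have dQ := @colours_occupied sg1 V1.
have eB := @colours_occupied sg1 V2.
move: kP dQ eB; rewrite -/P -/Q -/B.
move: (fun l => _) (fun l => _) (fun l => _) => e d k kP dQ eB ok1 ok2.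
set Q' := reflect_row P Q B.
have Q'_ok : size P = (size Q).+1 -> size Q = (size B).+1 ->
    interlaced (opposite T) P Q' -> interlaced T Q' B ->
    sorted gtn Q' /\ all (gtn N) Q'.
  move=> szP szQ PQ' Q'B; have szQ' : size Q' = size Q by rewrite size_mkseq.
  split.
    apply: (interlaced_sorted erefl (etrans szQ' szQ) PQ').
    by case: (T) Q'B.
  apply/(all_nthP 0) => l lQ'.
  (* The new entries are bounded by those of [P], hence are columns of the lattice. *)
  have : nth 0 P l \in P by rewrite mem_nth // szP -szQ' ltnS ltnW.
  rewrite mem_occupied => /andP[PN _]; apply: leq_ltn_trans PN.
  by have := PQ' l lQ'; case: (T) => /=; lia.
have nQ' l : l <= size B -> size Q = (size B).+1 ->
    nth 0 Q' l = upper P B l + lower P B l - nth 0 Q l.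
  by move=> lB szQ; rewrite nth_mkseq // szQ.
case: T ok1 ok2 Q'_ok => /=.
- rewrite (gamma_rowP _ kP dQ) (delta_rowP _ dQ eB) -/P -/Q -/B.
  move=> [szP PQ R1] [szQ QB R2] Q'_ok.
  have LU : forall l, l <= size B -> lower P B l <= nth 0 Q l < upper P B l :=
    interlaced_between (T := Gamma) erefl szQ PQ QB.
  have szQ' : size Q' = (size B).+1 by rewrite size_mkseq szQ.
  have [PQ' Q'B] : interlaced Delta P Q' /\ interlaced Gamma Q' B.
    apply: (between_interlaced (T := Delta) erefl szQ') => l lB.
    by rewrite nQ' //=; have := LU l lB; lia.
  have [Q's Q'N] := Q'_ok szP szQ PQ' Q'B.
  pose x l := nth 0 Q l == lower P B l.
  rewrite szQ in R1.
  have [] := @gamma_delta_exchange m (size B) (nth 0 P) (nth 0 B) x _ _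
    (fun l => nth 0 Q' l == nth 0 P l)
    (fun l => nth 0 B l == nth 0 Q' l.+1) _ _ _ _ _ _ _ _ _ _ _ R1 R2.
  1-6: try move=> l lB.
  (* As [lower] is a maximum, q_l meets p_{l+1} or b_l exactly when it equals the bound and that
     entry attains it. *)
  + by have := LU l; have := PQ l; have := QB l lB; rewrite /x /lower lB szQ; lia.
  + by have := LU l; have := PQ l; have := QB l lB; rewrite /x /lower lB szQ; lia.
  (* Reflection carries L to U, so the new entry attains the minimum of p_{l+1} and b_l exactly when
     the bit is set. *)
  + rewrite nQ' // /x; have := LU l.+1 lB; have := PQ l.+1.
    by rewrite /upper szQ /=; lia.
  + rewrite nQ' // /x; have := LU l.+1 lB; have := PQ l.+1.
    by rewrite /upper szQ /=; lia.
  + by rewrite /x /lower ltnn.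
  + by rewrite nQ' // /x; have := LU 0 isT; rewrite /upper /=; lia.
  move=> d' [R1' R2']; exists (fill Q' d').
  have Q'f := occupied_fill d' Q's Q'N.
  have d'Q' : colours (fill Q' d') (occupied N (fill Q' d')) d'.
    by rewrite Q'f; apply: colours_fill.
  split=> //.
    by apply/(delta_rowP _ kP d'Q'); rewrite Q'f; split=> //; rewrite szQ' // -szQ.
  by apply/(gamma_rowP _ d'Q' eB); rewrite Q'f; split=> //; rewrite szQ'.
- rewrite (delta_rowP _ kP dQ) (gamma_rowP _ dQ eB) -/P -/Q -/B.
  move=> [szP PQ R1] [szQ QB R2] Q'_ok.
  have LU : forall l, l <= size B -> lower P B l < nth 0 Q l <= upper P B l :=
    interlaced_between (T := Delta) erefl szQ PQ QB.
  have szQ' : size Q' = (size B).+1 by rewrite size_mkseq szQ.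
  have [PQ' Q'B] : interlaced Gamma P Q' /\ interlaced Delta Q' B.
    apply: (between_interlaced (T := Gamma) erefl szQ') => l lB.
    by rewrite nQ' //=; have := LU l lB; lia.
  have [Q's Q'N] := Q'_ok szP szQ PQ' Q'B.
  (* Here U is the end that can be attained, and reflection carries it to L. *)
  pose x l := nth 0 Q l == upper P B l.
  rewrite szQ in R1.
  have [] := @delta_gamma_exchange m (size B) (nth 0 P) (nth 0 B) x
    (fun l => nth 0 Q' l == nth 0 P l.+1)
    (fun l => nth 0 B l == nth 0 Q' l) _ _ _ _ _ _ _ _ _ _ _ _ _ R1 R2.
  1-6: try move=> l lB.
  + rewrite (nQ' l (ltnW lB) szQ) /x; have := LU l (ltnW lB); have := PQ l.
    by rewrite /lower szQ lB; lia.
  + rewrite (nQ' l (ltnW lB) szQ) /x; have := LU l (ltnW lB); have := PQ l.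
    by rewrite /lower szQ lB; lia.
  + by have := LU l.+1 lB; have := QB l lB; rewrite /x /upper /=; lia.
  + by have := LU l.+1 lB; have := QB l lB; rewrite /x /upper /=; lia.
  + by rewrite nQ' // /x; have := LU _ (leqnn _); rewrite /lower ltnn; lia.
  + by rewrite /x /upper.
  move=> d' [R1' R2']; exists (fill Q' d').
  have Q'f := occupied_fill d' Q's Q'N.
  have d'Q' : colours (fill Q' d') (occupied N (fill Q' d')) d'.
    by rewrite Q'f; apply: colours_fill.
  split=> //.
    by apply/(gamma_rowP _ kP d'Q'); rewrite Q'f; split=> //; rewrite szQ' // -szQ.
  by apply/(delta_rowP _ d'Q' eB); rewrite Q'f; split=> //; rewrite szQ'.
Qed.
End Exchange.
End TwoRows.

(** * States and patterns *)

Section RowOk.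
Variables (m N : nat).
Implicit Types (T : row_type) (h V : nat -> option 'I_m) (sg : 'I_m).

Lemma row_ok_edges T h V0 V1 sg : row_ok T N h V0 V1 sg <->
  (if T is Gamma then h N = None /\ h 0 = Some sg
   else h 0 = None /\ h N = Some sg) /\
  (forall c, c < N -> if T is Gamma then step T (h c.+1) (V0 c) (h c) (V1 c)
                      else step T (h c) (V0 c) (h c.+1) (V1 c)).
Proof.
rewrite /row_ok /hand; case: T => /=; rewrite ?subn0 ?subnn.
  split=> [[hN h0 hS]|[[hN h0] hS]]; split=> // c cN.
    have := hS (N - c.+1); rewrite (nth_columns Gamma) /= ?subnSK //; try by lia.
    by rewrite !subKn ?(ltnW cN) // => -> //; lia.
  rewrite (nth_columns Gamma) //= -(subnSK cN); apply: hS; lia.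
by split=> [[h0 hN hS]|[[h0 hN] hS]]; split=> // c cN; have := hS c cN;
  rewrite (nth_columns Delta).
Qed.

Lemma row_ok_ext T h h' V0 V0' V1 V1' sg :
  (forall k, k <= N -> h k = h' k) -> (forall c, c < N -> V0 c = V0' c) ->
  (forall c, c < N -> V1 c = V1' c) ->
  row_ok T N h V0 V1 sg -> row_ok T N h' V0' V1' sg.
Proof.
move=> hE V0E V1E /row_ok_edges[bd hS]; apply/row_ok_edges.
split=> [|c cN]; first by rewrite -!hE.
by rewrite -!hE ?(ltnW cN) // -V0E // -V1E //; apply: hS.
Qed.

Lemma row_ok_interlaced T h V0 V1 sg : row_ok T N h V0 V1 sg ->
  size (occupied N V0) = (size (occupied N V1)).+1 /\
  interlaced T (occupied N V0) (occupied N V1).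
Proof.
have kP := @colours_occupied _ N sg V0; have dQ := @colours_occupied _ N sg V1.
case: T => ok.
  by have [] := (gamma_rowP sg kP dQ).1 (ex_intro _ h ok).
by have [] := (delta_rowP sg kP dQ).1 (ex_intro _ h ok).
Qed.

(** Conservation of particles fixes the occupancy of the outgoing hand, and sorting fixes the
    colours. *)
Lemma step_inj T oa ot ob ob' od od' :
  @step m T oa ot ob od -> step T oa ot ob' od' -> isSome od = isSome od' ->
  ob = ob' /\ od = od'.
Proof.
case: oa => [a|]; case: ot => [t|]; case: ob => [b|]; case: ob' => [b'|];
  case: od => [d|]; case: od' => [d'|] //=.
all: try by move=> /eqP-> /eqP->.
by move=> /eqP E /eqP E'; move: E; rewrite -E' => -[-> ->].
Qed.

(** The hands are compared in reading order from the common empty start; [step_inj] forces each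
    step. *)
Lemma row_ok_inj T h h' V0 V0' V1 V1' sg sg' :
  row_ok T N h V0 V1 sg -> row_ok T N h' V0' V1' sg' ->
  (forall c, c < N -> V0 c = V0' c) ->
  (forall c, c < N -> isSome (V1 c) = isSome (V1' c)) ->
  (forall k, k <= N -> h k = h' k) /\ (forall c, c < N -> V1 c = V1' c).
Proof.
move=> [h0 _ hS] [h0' _ hS'] V0E V1E.
have colN i : i < N -> nth 0 (columns T N) i < N.
  by move=> iN; rewrite nth_columns //; case: (T); lia.
have E i : i <= N -> hand T N h i = hand T N h' i.
  elim: i => [|i IHi] iN; first by rewrite h0 h0'.
  have st := hS i iN; have st' := hS' i iN; have cN := colN i iN.
  rewrite /= IHi ?(ltnW iN) // (V0E _ cN) in st.
  by have [] := step_inj st st' (V1E _ cN).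
split=> [k kN|c cN].
  by case: T E {hS hS' colN h0 h0'} => /= E; [have := E (N - k); rewrite subKn // => ->;
     rewrite ?leq_subr | apply: E].
pose i := if T is Gamma then N - c.+1 else c.
have iN : i < N by rewrite /i; case: (T); lia.
have ci : nth 0 (columns T N) i = c by rewrite nth_columns // /i; case: (T); lia.
have := hS i iN; have := hS' i iN; rewrite /= ci V0E // !E // ?(ltnW iN) //.
by move=> st' st; have [] := step_inj st st' (V1E _ cN).
Qed.

End RowOk.

Section States.
Variables (m r N : nat).
Implicit Types (s : labelling m r N) (Theta : r.-tuple row_type).

(** Edges indexed by naturals, empty outside the lattice, so that the results on single rows apply
    without ordinals. *)
Definition hat s (t k : nat) : option 'I_m :=
  if insub t is Some t' then if insub k is Some k' then s.1 t' k' else None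
  else None.

Definition vat s (j c : nat) : option 'I_m :=
  if insub j is Some j' then if insub c is Some c' then s.2 j' c' else None
  else None.

Lemma hatE s (t : 'I_r) (k : 'I_N.+1) (n : nat) : n = k -> hat s t n = s.1 t k.
Proof. by move=> ->; rewrite /hat !valK. Qed.

Lemma vatE s (j : 'I_r.+1) (c : 'I_N) (n n' : nat) :
  n = j -> n' = c -> vat s n n' = s.2 j c.
Proof. by move=> -> ->; rewrite /vat !valK. Qed.

(** A pattern has no row r; there the default [[::]] agrees with the empty bottom boundary. *)
Lemma nth_state_pattern s j : bottom_boundary s -> j <= r ->
  nth [::] (state_pattern s) j = occupied N (vat s j).
Proof.
move=> /forallP bot; rewrite leq_eqVlt => /predU1P[->|jr].
  rewrite nth_default ?size_tuple //; apply/esym/eqP; rewrite -size_eq0 size_filter.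
  rewrite -leqn0 leqNgt -has_count -all_predC; apply/allP => c.
  rewrite mem_rev mem_iota => /= cN; rewrite (@vatE _ ord_max (Ordinal cN)) //.
  by rewrite (eqP (bot _)).
rewrite -[j]/(val (Ordinal jr)) -tnth_nth tnth_mktuple /occupied.
rewrite -val_enum_ord -map_rev filter_map; congr map.
by apply: eq_filter => c /=; rewrite (@vatE _ (widen_ord (leqnSn r) (Ordinal jr)) c).
Qed.

Section Fixed.
Variables (R : nzRingType) (z : 'I_r -> R).
Variables (kappa : r.-tuple 'I_m) (la : r.-tuple nat).
Hypothesis z_neq0 : forall t, z t != 0%R.

Lemma states_withP Theta sigma s :
  reflect ((forall t : 'I_r, row_ok (tnth Theta t) N (hat s t) (vat s t)
                               (vat s t.+1) (tnth sigma t))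
           /\ top_boundary kappa la s /\ bottom_boundary s)
          (s \in states_with N z kappa la Theta sigma).
Proof.
have edgeE (t : 'I_r) (c : 'I_N) :
  [/\ hat s t c.+1 = left_edge s t c, hat s t c = right_edge s t c,
      vat s t c = top_edge s t c & vat s t.+1 c = bottom_edge s t c].
  by split; [apply: hatE|apply: hatE|apply: vatE|apply: vatE]; rewrite //= /bump.
rewrite inE; apply: (iffP and4P).
  move=> [/forallP adm top bot /forallP side]; split=> // t.
  apply/row_ok_edges; split=> [|c cN].
    have := side t; case: (tnth Theta t) => /andP[/eqP E1 /eqP E2]; split.
    - by rewrite (@hatE _ _ ord_max).
    - by rewrite (@hatE _ _ ord0).
    - by rewrite (@hatE _ _ ord0).
    - by rewrite (@hatE _ _ ord_max).
  have /forallP/(_ (Ordinal cN)) := adm t; rewrite vertex_weight_neq0 //.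
  by have /= [-> -> -> ->] := edgeE t (Ordinal cN).
move=> [rows [top bot]]; split=> //.
  apply/forallP => t; apply/forallP => c; rewrite vertex_weight_neq0 //.
  have /row_ok_edges[_ /(_ c (ltn_ord c))] := rows t.
  by have [-> -> -> ->] := edgeE t c.
apply/forallP => t; have /row_ok_edges[+ _] := rows t.
rewrite (@hatE _ _ ord_max) // (@hatE _ _ ord0) //.
by case: (tnth Theta t) => -[-> ->]; rewrite !eqxx.
Qed.

Lemma top_boundary_eq s1 s2 c : top_boundary kappa la s1 -> top_boundary kappa la s2 ->
  c < N -> vat s1 0 c = vat s2 0 c.
Proof.
move=> /andP[/forallP k1 /forallP e1] /andP[/forallP k2 /forallP e2] cN.
rewrite !(@vatE _ ord0 (Ordinal cN)) //.
have [/tnthP[t ct]|nc] := boolP (c \in add_rho la).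
  have /forallP/(_ (Ordinal cN))/implyP/(_ (introT eqP ct))/eqP-> := k1 t.
  by have /forallP/(_ (Ordinal cN))/implyP/(_ (introT eqP ct))/eqP-> := k2 t.
have /implyP/(_ nc)/eqP-> := e1 (Ordinal cN).
by have /implyP/(_ nc)/eqP-> := e2 (Ordinal cN).
Qed.

(** The top boundary is fixed, and each row passes the equality of vertical edges one level down. *)
Lemma state_pattern_inj Theta sigma1 sigma2 s1 s2 :
  s1 \in states_with N z kappa la Theta sigma1 ->
  s2 \in states_with N z kappa la Theta sigma2 ->
  state_pattern s1 = state_pattern s2 -> s1 = s2.
Proof.
move=> /states_withP[rows1 [top1 bot1]] /states_withP[rows2 [top2 bot2]] pE.
have occE j c : j <= r -> c < N -> isSome (vat s1 j c) = isSome (vat s2 j c).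
  move=> jr cN; have := congr1 (fun p : pattern r => c \in nth [::] p j) pE.
  by rewrite !nth_state_pattern // !mem_occupied cN.
have vE j : j <= r -> forall c, c < N -> vat s1 j c = vat s2 j c.
  elim: j => [|j IHj] jr c cN; first exact: top_boundary_eq.
  have [_] := row_ok_inj (rows1 (Ordinal jr)) (rows2 (Ordinal jr))
    (IHj (ltnW jr)) (fun c => @occE _ c jr).
  exact.
have hE (t : 'I_r) k : k <= N -> hat s1 t k = hat s2 t k.
  have [+ _] := row_ok_inj (rows1 t) (rows2 t) (vE _ (ltnW (ltn_ord t)))
    (fun c => @occE _ c (ltn_ord t)).
  exact.
case: s1 s2 vE hE {rows1 rows2 top1 top2 bot1 bot2 pE occE} => [h1 v1] [h2 v2] vE hE.
congr (_, _); apply/matrixP => t c.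
  by have := hE t c (leq_ord c); rewrite !(@hatE _ t c).
by have := vE t (leq_ord t) c (ltn_ord c); rewrite !(@vatE _ t c).
Qed.

(** Counted upwards from the empty bottom: each row has one more particle above than below. *)
Lemma size_occupied Theta sigma s j :
  s \in states_with N z kappa la Theta sigma -> j <= r ->
  size (occupied N (vat s j)) = r - j.
Proof.
move=> /states_withP[rows [_ bot]].
have [n] := ubnP (r - j); elim: n j => // n IHn j rj jr.
have [->|lt_jr] := eqVneq j r.
  by rewrite -nth_state_pattern // nth_default ?size_tuple ?subnn.
have {}jr : j < r by rewrite ltn_neqAle lt_jr.
by have [-> _] := row_ok_interlaced (rows (Ordinal jr)); rewrite /= IHn //; lia.
Qed.

Hypothesis la_part : sorted geq la.
Hypothesis N_large : nth 0 la 0 + r <= N.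

Lemma nth_add_rho l : l < r -> nth 0 (add_rho la) l = nth 0 la l + (r - l.+1).
Proof.
move=> lr; rewrite -[l]/(val (Ordinal lr)) -!tnth_nth !tnth_mktuple.
by rewrite (tnth_nth 0).
Qed.

Lemma top_occupied s : top_boundary kappa la s ->
  occupied N (vat s 0) = add_rho la.
Proof.
move=> /andP[/forallP k1 /forallP e1].
have la_geq l l' : l <= l' -> l' < r -> nth 0 la l' <= nth 0 la l.
  have geq_trans : transitive geq by move=> x y w /= /[swap]; apply: leq_trans.
  move=> ll' l'r; apply: (sorted_leq_nth geq_trans leqnn 0 la_part) => //;
    by rewrite inE size_tuple // (leq_ltn_trans ll').
apply: occupied_eq.
- apply/(sortedP 0) => l; rewrite size_tuple => lr /=.
  by rewrite !nth_add_rho ?(ltnW lr) //; have := la_geq l l.+1 (leqnSn l) lr; lia.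
- move=> c cN; rewrite (@vatE _ ord0 (Ordinal cN)) //.
  have [/tnthP[t ct]|nc] := boolP (c \in add_rho la).
    by have /forallP/(_ (Ordinal cN))/implyP/(_ (introT eqP ct))/eqP-> := k1 t.
  by have /implyP/(_ nc)/eqP-> := e1 (Ordinal cN).
apply/(all_nthP 0) => l; rewrite size_tuple => lr /=; rewrite nth_add_rho //.
by have := la_geq 0 l isT lr; lia.
Qed.

Lemma state_pattern_GTP Theta sigma s :
  s \in states_with N z kappa la Theta sigma ->
  GTP (add_rho la) Theta (state_pattern s).
Proof.
move=> sS; have /states_withP[rows [top bot]] := sS.
apply/and3P; split.
- by rewrite nth_state_pattern // top_occupied.
- apply/forallP => j; rewrite (tnth_nth [::]) nth_state_pattern // 1?ltnW //.
  by rewrite (size_occupied sS) // ltnW.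
apply/forallP => t; apply/forallP => l; apply/implyP => tl.
have [_] := row_ok_interlaced (rows t).
have tr := ltn_ord t; have lr := ltn_ord l.
rewrite /interlaced (size_occupied sS) // => /(_ (l - t.+1)).
rewrite /entry !nth_state_pattern ?(ltnW tr) //.
(* Row t+1 stores entry l at the list index that entry l-1 has in row t. *)
have -> : l.-1 - t = l - t.+1 by lia.
have -> : l - t = (l - t.+1).+1 by lia.
by case: (tnth Theta t); lia.
Qed.

End Fixed.
End States.

(** List index l of row i+1 is the pattern entry i+1+l; the range tests of [toggle_entry] become
    those of [upper] and [lower]. *)
Lemma toggle_reflect (r i : nat) (p : pattern r) : i.+1 < r ->
  size (nth [::] p i.+1) = r - i.+1 -> size (nth [::] p i.+2) = r - i.+2 ->
  [seq toggle_entry i.+1 p l | l <- iota i.+1 (r - i.+1)] =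
  reflect_row (nth [::] p i) (nth [::] p i.+1) (nth [::] p i.+2).
Proof.
move=> ir szQ szB; apply: (@eq_from_nth _ 0); first by rewrite !size_map !size_iota szQ.
move=> l; rewrite size_map size_iota => lr.
rewrite (nth_map 0) ?size_iota // nth_iota // nth_mkseq ?szQ //.
rewrite /toggle_entry /entry /upper /lower szB /=.
have -> : i.+1 + l - i.+1 = l by lia.
have -> : (i.+1 + l).-1 - i = l by lia.
have -> : i.+1 + l - i = l.+1 by lia.
have -> : i.+1 + l - i.+2 = l.-1 by lia.
have -> : (i.+1 + l).+1 - i.+2 = l by lia.
have -> : (i.+1 < i.+1 + l < r) = (0 < l) by lia.
by have -> : (i.+1 < (i.+1 + l).+1 < r) = (l < r - i.+2) by lia.
Qed.

(** * Replacing two rows and the level between them *)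

Section Modify.
Variables (m r N : nat) (i j : 'I_r) (s : labelling m r N).
Variables (h1 h2 V : nat -> option 'I_m).

Definition modify : labelling m r N :=
  (\matrix_(t, k) (if t == i then h1 k else if t == j then h2 k else s.1 t k),
   \matrix_(l, c) (if l == j :> nat then V c else s.2 l c))%R.

Lemma hat_modify (t : 'I_r) k : k <= N ->
  hat modify t k = if t == i then h1 k else if t == j then h2 k else hat s t k.
Proof.
move=> kN; have kN1 : k < N.+1 by [].
by rewrite !(@hatE _ _ _ _ t (Ordinal kN1)) // mxE.
Qed.

Lemma vat_modify l c : l <= r -> c < N ->
  vat modify l c = if l == j then V c else vat s l c.
Proof.
move=> lr cN; have lr1 : l < r.+1 by [].
by rewrite !(@vatE _ _ _ _ (Ordinal lr1) (Ordinal cN)) // mxE.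
Qed.
End Modify.

Theorem theorem4p10 (R : nzRingType) (m r N : nat) (z : 'I_r -> R)
  (kappa : r.-tuple 'I_m) (la : r.-tuple nat) (Theta : r.-tuple row_type)
  (i j : 'I_r) (sigma : r.-tuple 'I_m)
  (z_neq0 : forall t, z t != 0%R)
  (la_part : sorted geq la)
  (N_large : nth 0 la 0 + r <= N)
  (ij_adj : j = i.+1 :> nat)
  (Theta_ij : tnth Theta i <> tnth Theta j)
  (s : labelling m r N) :
  s \in states_with N z kappa la Theta sigma ->
  exists2 s' : labelling m r N,
    toggle_state z kappa la i j Theta s = Some s' &
    s' \in states_with N z kappa la (swap i j Theta) (swap i j sigma).
Proof.
move=> sS; have /(states_withP _ _ z_neq0)[rows [top bot]] := sS.
have ir : i.+1 < r by rewrite -ij_adj.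
have Tj : tnth Theta j = opposite (tnth Theta i).
  by move: Theta_ij; case: (tnth Theta i); case: (tnth Theta j).
have rowi : exists h, row_ok (tnth Theta i) N h (vat s i) (vat s i.+1) (tnth sigma i).
  by exists (hat s i).
have rowj : exists h, row_ok (opposite (tnth Theta i)) N h (vat s i.+1) (vat s i.+2)
                        (tnth sigma j).
  by exists (hat s j); rewrite -Tj -ij_adj.
(* Levels i, i+1 and i+2 play the parts of p, q and b. *)
have [V [occV [h1 ok1] [h2 ok2]]] := reflect_rows rowi rowj.
pose s' := modify i j s h1 h2 V.
have ji : (j == i) = false by apply/eqP => ji; move: ij_adj; rewrite ji => /n_Sn.
have hE := hat_modify i j s h1 h2 V; have vE := vat_modify i j s h1 h2 V.
have s'S : s' \in states_with N z kappa la (swap i j Theta) (swap i j sigma).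
  apply/states_withP => //; split.
    move=> t; rewrite !tnth_mktuple; have tr := ltn_ord t.
    have [->|ti] := eqVneq t i.
      rewrite tpermL Tj; apply: row_ok_ext ok1 => [k kN|c cN|c cN].
      - by rewrite hE // eqxx.
      - by rewrite vE // 1?ltnW // ij_adj ltn_eqF.
      - by rewrite vE // ij_adj eqxx.
    have [->|tj] := eqVneq t j.
      rewrite tpermR; apply: row_ok_ext ok2 => [k kN|c cN|c cN].
      - by rewrite hE // ji eqxx.
      - by rewrite vE // 1?ltnW // eqxx.
      - by rewrite vE // gtn_eqF // ij_adj.
    rewrite tpermD 1?eq_sym //; apply: row_ok_ext (rows t) => [k kN|c cN|c cN].
    - by rewrite hE // (negbTE ti) (negbTE tj).
    - by rewrite vE // 1?ltnW // -[_ == _]/(t == j) (negbTE tj).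
    - rewrite vE // ij_adj eqSS -[_ == _]/(t == i) (negbTE ti) //.
  have v0 c : s'.2 ord0 c = s.2 ord0 c by rewrite mxE /= ij_adj.
  split.
    case/andP: top => /forallP k1 /forallP e1; apply/andP; split.
      apply/forallP => t; apply/forallP => c; rewrite v0.
      by have /forallP := k1 t; apply.
    by apply/forallP => c; rewrite v0; apply: e1.
  apply/forallP => c; rewrite mxE /= gtn_eqF //; by move/forallP: bot; apply.
exists s' => //.
have /(states_withP _ _ z_neq0)[_ [_ bot']] := s'S.
have pE : toggle j (state_pattern s) = state_pattern s'.
  apply: eq_from_tnth => t; rewrite tnth_mktuple !(tnth_nth [::]).
  have tr := ltnW (ltn_ord t); rewrite !nth_state_pattern //.
  have [tj|tj] := eqVneq (t : nat) j; last first.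
    apply: eq_in_filter => c; rewrite mem_rev mem_iota => /= cN.
    by rewrite vE // (negbTE tj).
  have -> : occupied N (vat s' t) = occupied N V.
    apply: eq_in_filter => c; rewrite mem_rev mem_iota => /= cN.
    by rewrite vE // tj eqxx.
  have szE l : l <= r -> size (nth [::] (state_pattern s) l) = r - l.
    by move=> lr; rewrite nth_state_pattern // (size_occupied z_neq0 sS lr).
  (* If j is the last row, level i+2 is the bottom boundary, read from the pattern as [[::]]. *)
  by rewrite occV ij_adj toggle_reflect ?szE ?nth_state_pattern //; lia.
rewrite /toggle_state /pattern_state pE.
rewrite (state_pattern_GTP z_neq0 la_part N_large s'S).
(* Injectivity of the pattern map leaves a single preimage, which [unset1] extracts. *)
have -> : [set s0 in states N z kappa la (swap i j Theta)
            | state_pattern s0 == state_pattern s'] = [set s'].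
  apply/setP => s0; rewrite !inE; apply/andP/eqP => [[/bigcupP[sg _ s0S] /eqP E]|->].
    exact: (state_pattern_inj z_neq0 s0S s'S E).
  by split=> //; apply/bigcupP; exists (swap i j sigma).
exact: set1K.
Qed.
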